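(* Let $G = (V(G), E(G), \mathbf{s}, \mathbf{r})$ be a non-trivial directed graph. The following statements hold: (i) $\mathrm{gr}(\Gamma(I(G))) \in \{3, \infty\}$; (ii) $\mathrm{gr}(\Gamma(I(G))) = \infty$ if and only if $|V(G)| = 2$ and $|E(G)| = 0$; (iii) $\mathrm{gr}(\Gamma(I(G))) = 3$ if and only if either $|E(G)| \ne 0$, or $|V(G)| \ge 3$ and $|E(G)| = 0$.
   Context: A directed graph $G=(V(G),E(G),\mathbf{s},\mathbf{r})$ has a non-empty vertex set $V(G)$, an edge set $E(G)$ (loops and multiple edges allowed), and source and range maps $\mathbf{s},\mathbf{r}:E(G)\to V(G)$. It is trivial if it consists of one isolated vertex (one vertex, no edges); non-trivial otherwise. $\mathrm{Path}(G)$ is the set of all finite directed paths $p=e_1\cdots e_n$ (with $\mathbf{r}(e_i)=\mathbf{s}(e_{i+1})$, $\mathbf{s}(p)=\mathbf{s}(e_1)$, $\mathbf{r}(p)=\mathbf{r}(e_n)$), including each vertex $v$ as an empty path with $\mathbf{s}(v)=\mathbf{r}(v)=v$; $p^{-1}=e_n^{-1}\cdots e_1^{-1}$ and $v^{-1}=v$. The graph inverse semigroup $I(G)$ is the semigroup with zero generated by $V(G)\cup E(G)\cup\{e^{-1}:e\in E(G)\}$ subject to, for $u,v\in V(G)$, $e,f\in E(G)$: $uv=\delta_{u,v}u$; $\mathbf{s}(e)e=e\mathbf{r}(e)=e$; $\mathbf{r}(e)e^{-1}=e^{-1}\mathbf{s}(e)=e^{-1}$; $e^{-1}f=\delta_{e,f}\mathbf{r}(e)$.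 Every non-zero element is uniquely $pq^{-1}$ with $p,q\in\mathrm{Path}(G)$, $\mathbf{r}(p)=\mathbf{r}(q)$; $(pq^{-1})(rs^{-1})$ equals $pts^{-1}$ if $r=qt$, $p(st)^{-1}$ if $q=rt$ (for a possibly empty path $t$), and $0$ otherwise. $I(G)$ is an inverse semigroup with idempotents $pp^{-1}$ ($p\in\mathrm{Path}(G)$) and $0$. For an inverse semigroup $T$ with zero, the natural partial order is $a\le b$ iff $a=eb$ for some idempotent $e$; $\omega(a,b)=\{c\in T:c\le a \text{ and } c\le b\}$. The zero-divisor graph $\Gamma(T)$ is the simple undirected graph with vertex set $Z(T)^\times=\{a\in T\setminus\{0\}:\exists\,b\in T\setminus\{0\},\ \omega(a,b)=\{0\}\}$, where distinct vertices $a,b$ are adjacent iff $\omega(a,b)=\{0\}$. The girth $\mathrm{gr}$ of a graph is the length of a shortest cycle, or $\infty$ if there are no cycles. *)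

(* Defs.v *)
From HB Require Import structures.
From mathcomp Require Import all_boot.
From mathcomp Require Import boolp classical_sets functions cardinality.

Set Implicit Arguments.
Unset Strict Implicit.
Unset Printing Implicit Defensive.

Local Open Scope classical_set_scope.
Local Open Scope card_scope.
Local Open Scope quotient_scope.
Local Open Scope group_scope.

(* The vertex and edge types are arbitrary, possibly infinite. *)
Record digraph := Digraph {
  vertex : Type;
  edge : Type;
  src : edge -> vertex;
  rng : edge -> vertex;
  vertex_neq0 : [set: vertex] !=set0
}.

Definition trivial_digraph (G : digraph) : Prop :=
  [set: vertex G] #= `I_1 /\ [set: edge G] #= `I_0.

HB.mixin Record Semigroup_hasZero T of Semigroup T := {
  zeros : T;
  mul0s : left_zero zeros (fun x y : T => x * y);
  muls0 : right_zero zeros (fun x y : T => x * y)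
}.

#[short(type="zsemigroupType")]
HB.structure Definition ZSemigroup := {T of Semigroup_hasZero T & Semigroup T}.

Arguments zeros {s}.

(* I(G) is built literally from its presentation: formal products of the
   generators and zero, modulo the least congruence that contains
   associativity, the absorption laws of zero and the defining relations. *)
Inductive gis_term (G : digraph) : Type :=
  | GZero
  | GVertex of vertex G
  | GEdge of edge G
  | GInv of edge G
  | GMul of gis_term G & gis_term G.

Arguments GZero {G}.
Arguments GVertex {G} _.
Arguments GEdge {G} _.
Arguments GInv {G} _.

Inductive gis_eq (G : digraph) : gis_term G -> gis_term G -> Prop :=
  | gis_refl a : gis_eq a a
  | gis_sym a b : gis_eq a b -> gis_eq b a
  | gis_trans a b c : gis_eq a b -> gis_eq b c -> gis_eq a c
  | gis_mul a a' b b' :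
      gis_eq a a' -> gis_eq b b' -> gis_eq (GMul a b) (GMul a' b')
  | gis_mulA a b c : gis_eq (GMul a (GMul b c)) (GMul (GMul a b) c)
  | gis_mul0l a : gis_eq (GMul GZero a) GZero
  | gis_mul0r a : gis_eq (GMul a GZero) GZero
  | gis_vv v : gis_eq (GMul (GVertex v) (GVertex v)) (GVertex v)
  | gis_uv u v : u <> v -> gis_eq (GMul (GVertex u) (GVertex v)) GZero
  | gis_src_edge e : gis_eq (GMul (GVertex (src e)) (GEdge e)) (GEdge e)
  | gis_edge_rng e : gis_eq (GMul (GEdge e) (GVertex (rng e))) (GEdge e)
  | gis_rng_inv e : gis_eq (GMul (GVertex (rng e)) (GInv e)) (GInv e)
  | gis_inv_src e : gis_eq (GMul (GInv e) (GVertex (src e))) (GInv e)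
  | gis_inv_edge e : gis_eq (GMul (GInv e) (GEdge e)) (GVertex (rng e))
  | gis_inv_edge0 e f : e <> f -> gis_eq (GMul (GInv e) (GEdge f)) GZero.

HB.instance Definition _ (G : digraph) := gen_eqMixin (gis_term G).
HB.instance Definition _ (G : digraph) := gen_choiceMixin (gis_term G).

Definition gis_eqb (G : digraph) : rel (gis_term G) :=
  fun a b => `[< gis_eq a b >].

Lemma gis_eqb_refl (G : digraph) : reflexive (@gis_eqb G).
Proof. by move=> a; apply/asboolP/gis_refl. Qed.

Lemma gis_eqb_sym (G : digraph) : symmetric (@gis_eqb G).
Proof. by move=> a b; apply/asboolP/asboolP; apply: gis_sym. Qed.

Lemma gis_eqb_trans (G : digraph) : transitive (@gis_eqb G).
Proof.
by move=> b a c /asboolP ab /asboolP bc; apply/asboolP/(gis_trans ab bc).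
Qed.

Definition gis_equiv (G : digraph) : equiv_rel (gis_term G) :=
  EquivRel (@gis_eqb G)
    (@gis_eqb_refl G) (@gis_eqb_sym G) (@gis_eqb_trans G).

Definition graph_inverse_semigroup (G : digraph) : Type :=
  {eq_quot (gis_equiv G)}.

HB.instance Definition _ (G : digraph) :=
  Choice.copy (graph_inverse_semigroup G) {eq_quot (gis_equiv G)}.
HB.instance Definition _ (G : digraph) :=
  Quotient.copy (graph_inverse_semigroup G) {eq_quot (gis_equiv G)}.

Lemma gis_piP (G : digraph) (a b : gis_term G) :
  \pi_(graph_inverse_semigroup G) a = \pi_(graph_inverse_semigroup G) b <->
  gis_eq a b.
Proof.
split=> [/(eqmodP (gis_equiv G))/asboolP //|ab].
by apply/(eqmodP (gis_equiv G))/asboolP.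
Qed.

Definition gis_mulg (G : digraph) (x y : graph_inverse_semigroup G) :
    graph_inverse_semigroup G :=
  \pi_(graph_inverse_semigroup G) (GMul (repr x) (repr y)).

Definition gis_zero (G : digraph) : graph_inverse_semigroup G :=
  \pi_(graph_inverse_semigroup G) GZero.

Lemma gis_mulgE (G : digraph) (a b : gis_term G) :
  gis_mulg (\pi_(graph_inverse_semigroup G) a)
           (\pi_(graph_inverse_semigroup G) b) =
  \pi_(graph_inverse_semigroup G) (GMul a b).
Proof. by apply/gis_piP/gis_mul; apply/gis_piP; rewrite reprK. Qed.

Lemma gis_mulgA (G : digraph) : associative (@gis_mulg G).
Proof.
elim/quotW=> a; elim/quotW=> b; elim/quotW=> c.
rewrite (gis_mulgE b c) (gis_mulgE a b) (gis_mulgE a) (gis_mulgE _ c).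
exact/gis_piP/gis_mulA.
Qed.

HB.instance Definition _ (G : digraph) :=
  isSemigroup.Build (graph_inverse_semigroup G) (@gis_mulgA G).

Lemma gis_mul0g (G : digraph) :
  left_zero (gis_zero G) (fun x y : graph_inverse_semigroup G => x * y).
Proof.
by elim/quotW=> a; rewrite [LHS]gis_mulgE; apply/gis_piP/gis_mul0l.
Qed.

Lemma gis_mulg0 (G : digraph) :
  right_zero (gis_zero G) (fun x y : graph_inverse_semigroup G => x * y).
Proof.
by elim/quotW=> a; rewrite [LHS]gis_mulgE; apply/gis_piP/gis_mul0r.
Qed.

HB.instance Definition _ (G : digraph) :=
  Semigroup_hasZero.Build (graph_inverse_semigroup G)
    (@gis_mul0g G) (@gis_mulg0 G).

(* The notions below only use the product and the zero, so they are stated for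
   any semigroup with zero; nat_le is a partial order on inverse semigroups. *)
Definition nat_le (T : zsemigroupType) (a b : T) : Prop :=
  exists e : T, e * e = e /\ a = e * b.

Definition omega (T : zsemigroupType) (a b : T) : set T :=
  [set c | nat_le c a /\ nat_le c b].

Record sgraph := SGraph {
  sg_vertex : eqType;
  sg_adj : rel sg_vertex;
  sg_adj_sym : symmetric sg_adj;
  sg_adj_irrefl : irreflexive sg_adj
}.

Definition zero_divisors (T : zsemigroupType) : set T :=
  [set a | a <> zeros /\ exists b : T, b <> zeros /\ omega a b = [set zeros]].

Arguments zero_divisors : clear implicits.

Definition zdg_adj (T : zsemigroupType) : rel (set_type (zero_divisors T)) :=
  fun a b => (a != b) && `[< omega (val a) (val b) = [set zeros] >].

Lemma zdg_adj_sym (T : zsemigroupType) : symmetric (@zdg_adj T).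
Proof.
move=> a b; rewrite /zdg_adj eq_sym; congr (_ && `[< _ = _ >]).
by apply/seteqP; split=> c [].
Qed.

Lemma zdg_adj_irrefl (T : zsemigroupType) : irreflexive (@zdg_adj T).
Proof. by move=> a; rewrite /zdg_adj eqxx. Qed.

Definition zero_divisor_graph (T : zsemigroupType) : sgraph :=
  SGraph (@zdg_adj_sym T) (@zdg_adj_irrefl T).

(* [ucycle] also accepts sequences of size at most 2, which are not cycles of a
   simple graph. *)
Definition has_cycle_of_length (H : sgraph) (n : nat) : Prop :=
  (3 <= n)%N /\ exists c : seq (sg_vertex H), size c = n /\ ucycle (@sg_adj H) c.

Lemma has_cycle_of_length_ex (H : sgraph) :
  (exists n, has_cycle_of_length H n) ->
  exists n, `[< has_cycle_of_length H n >].
Proof. by case=> n Hn; exists n; apply/asboolP. Qed.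

(* [None] stands for infinite girth. *)
Definition girth (H : sgraph) : option nat :=
  match pselect (exists n, has_cycle_of_length H n) with
  | left ex => Some (ex_minn (has_cycle_of_length_ex ex))
  | right _ => None
  end.

(* Main.v *)
Require Import Defs.
From mathcomp Require Import all_boot.
From mathcomp Require Import boolp classical_sets functions cardinality.
From mathcomp Require Import ssralg ssrint zify.

(** An edge [e] yields the triangle [src e], [e], [e^-1]: the presentation is
    graded by degree 0, 1, -1 on vertices, edges and inverse edges, non-zero
    idempotents have degree 0, so elements of distinct degrees have no common
    non-zero lower bound. Distinct vertices are orthogonal idempotents, so three
    vertices also form a triangle; without edges the non-zero elements are
    exactly the vertices. That vertices are non-zero in [I(G)] is seen on the
    representation of [I(G)] by partial injections of paths. *)

Local Open Scope classical_set_scope.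
Local Open Scope card_scope.

(** * Girth of simple graphs *)

Lemma girth_eq3 (H : sgraph) (a b c : sg_vertex H) :
  sg_adj a b -> sg_adj b c -> sg_adj a c -> girth H = Some 3.
Proof.
move=> ab bc ac.
have neq x y : @sg_adj H x y -> x != y.
  by apply: contraTneq => ->; rewrite (@sg_adj_irrefl H).
have H3 : has_cycle_of_length H 3.
  split=> //; exists [:: a; b; c]; split=> //; apply/andP; split.
    by rewrite /= ab bc sg_adj_sym ac.
  by rewrite /= !inE negb_or (neq _ _ ab) (neq _ _ ac) (neq _ _ bc).
rewrite /girth; case: pselect => [ex|[]]; last by exists 3.
case: ex_minnP => n /asboolP[n3 _] /(_ 3) le3; congr Some.
(* Cycles have length at least 3 by definition; minimality of [n] gives the other inequality. *)
by apply/eqP; rewrite eqn_leq n3 le3 //; apply/asboolP.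
Qed.

(** The injection into [bool] leaves at most two vertices, while a cycle visits at least three
    distinct ones. *)
Lemma girth_eq_None (H : sgraph) (f : sg_vertex H -> bool) :
  injective f -> girth H = None.
Proof.
move=> fI; rewrite /girth; case: pselect => // ex; exfalso.
case: ex => n [n3 [c [sc /andP[_ uc]]]].
have := max_card [in map f c].
by rewrite card_bool (card_uniqP _) ?map_inj_uniq // size_map sc leqNgt n3.
Qed.

(** * Triangles in the zero-divisor graph of a semigroup with zero *)

Section Zero_divisors.
Variable T : zsemigroupType.
Implicit Types a b c : T.

Lemma omegaC a b : omega a b = omega b a.
Proof. by apply/seteqP; split=> c []. Qed.

Lemma omega_eq0 a b :
  (forall c, nat_le c a -> nat_le c b -> c = zeros) ->
  omega a b = [set zeros].
Proof.
move=> ab0; apply/seteqP; split=> [c [ca cb]|c ->]; first exact: ab0.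
by split; exists zeros; rewrite !(mul0s : forall x : T, _).
Qed.

Lemma girth_zero_divisor_graph_eq3 a b c :
  a <> zeros -> b <> zeros -> c <> zeros ->
  a <> b -> b <> c -> a <> c ->
  omega a b = [set zeros] -> omega b c = [set zeros] ->
  omega a c = [set zeros] ->
  girth (zero_divisor_graph T) = Some 3.
Proof.
move=> a0 b0 c0 nab nbc nac ab bc ac.
have za : zero_divisors T a by split=> //; exists b.
have zb : zero_divisors T b by split=> //; exists c.
have zc : zero_divisors T c by split=> //; exists b; rewrite omegaC.
pose mk x (zx : zero_divisors T x) : set_type (zero_divisors T) :=
  SigSub (mem_set zx).
have adj x y zx zy : x <> y -> omega x y = [set zeros] ->
    zdg_adj (mk x zx) (mk y zy).
  by move=> /eqP nxy xy; rewrite /zdg_adj -val_eqE /= nxy; apply/asboolP.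
apply: (@girth_eq3 (zero_divisor_graph T) (mk a za) (mk b zb) (mk c zc));
  exact: adj.
Qed.

End Zero_divisors.

(** * Path representation, degree and orthogonality in [I(G)] *)

Section Graph_inverse_semigroup.
Variable G : digraph.
Implicit Types (a b t : gis_term G) (u v : vertex G) (e : edge G).

Notation "[gis a ]" := (\pi_(graph_inverse_semigroup G)%qT a)
  (at level 0, format "[gis  a ]").

(* A list of edges followed by a vertex; consecutive edges need not be
   composable, which does not matter for the representation below. *)
Definition gis_path_src (x : seq (edge G) * vertex G) : vertex G :=
  if x.1 is e :: _ then src e else x.2.

(** [gis_act t x y] reads: the partial injection attached to [t] sends [y] to [x]. An edge prepends
    itself, its inverse removes it, a vertex is the identity on the paths starting there, and
    products are compositions. *)
Fixpoint gis_act t (x y : seq (edge G) * vertex G) : Prop :=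
  match t with
  | GZero => False
  | GVertex v => x = y /\ gis_path_src x = v
  | GEdge e => x = (e :: y.1, y.2) /\ gis_path_src y = rng e
  | GInv e => y = (e :: x.1, x.2) /\ gis_path_src x = rng e
  | GMul a b => exists z, gis_act a x z /\ gis_act b z y
  end.

Lemma gis_act_eq a b : gis_eq a b -> forall x y, gis_act a x y <-> gis_act b x y.
Proof.
elim=> {a b} //=.
- by move=> a b _ ab x y; rewrite ab.
- by move=> a b c _ ab _ bc x y; rewrite ab.
- move=> a a' b b' _ aa' _ bb' x y.
  by split=> -[z [/aa' az /bb' bz]]; exists z.
- move=> a b c x y; split.
    by move=> [z [az [w [bw cw]]]]; exists w; split=> //; exists z.
  by move=> [z [[w [aw bw]] cz]]; exists w; split=> //; exists z.
- by move=> a x y; split=> // -[z []].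
- by move=> a x y; split=> // -[z []].
- move=> v x y; split=> [[z [[<- _] //]]|[<- xv]].
  by exists x.
- by move=> u v uv x y; split=> // -[z [[<- xu] [_ xv]]]; apply: uv; rewrite -xu.
- move=> e x y; split=> [[z [[<- _] //]]|[-> ye]].
  by exists (e :: y.1, y.2).
- move=> e x y; split=> [[z [[-> ze] [<- _]]] //|[-> ye]].
  by exists y.
- move=> e x y; split=> [[z [[<- _] //]]|[-> xe]].
  by exists x.
- move=> e x y; split=> [[z [[-> xe] [<- _]]] //|[-> xe]].
  by exists (e :: x.1, x.2).
- move=> e x y; split=> [[z [[-> xe] [[xy1 xy2] _]]]|[<- xe]].
    by split=> //; case: x y xy1 xy2 {xe} => [? ?] [? ?] /= -> ->.
  by exists (e :: x.1, x.2); case: x xe.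
- by move=> e f ef x y; split=> // -[z [[-> _] [[]]]].
Qed.

(** The vertex [v] fixes the empty path at [v], whereas zero acts as the empty relation. *)
Lemma gis_vertex_neq0 v : ~ gis_eq (GVertex v) GZero.
Proof.
by move=> /gis_act_eq/(_ ([::], v) ([::], v)) /= [v0 _]; apply: v0.
Qed.

(** Otherwise the vertex [rng e], which is the product of [e^-1] and [e], would vanish. *)
Lemma gis_edge_neq0 e : ~ gis_eq (GEdge e) GZero.
Proof.
move=> e0; apply: (@gis_vertex_neq0 (rng e)).
apply: gis_trans (gis_sym (gis_inv_edge e)) _.
exact: gis_trans (gis_mul (gis_refl _) e0) (gis_mul0r _).
Qed.

Lemma gis_inv_neq0 e : ~ gis_eq (GInv e) GZero.
Proof.
move=> e0; apply: (@gis_vertex_neq0 (rng e)).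
apply: gis_trans (gis_sym (gis_inv_edge e)) _.
exact: gis_trans (gis_mul e0 (gis_refl _)) (gis_mul0l _).
Qed.

(* The value on [GZero] is junk. *)
Fixpoint gis_deg t : int :=
  match t with
  | GZero | GVertex _ => 0
  | GEdge _ => 1
  | GInv _ => -1
  | GMul a b => gis_deg a + gis_deg b
  end%R.

(** The alternative [gis_eq a GZero] is what makes the statement stable under the congruence: a zero
    factor annihilates the whole product, whatever its formal degree. *)
Lemma gis_deg_eq a b : gis_eq a b -> gis_eq a GZero \/ gis_deg a = gis_deg b.
Proof.
(* This also settles [gis_uv] and [gis_inv_edge0]: their left sides have degree 0, which agrees with
   the junk value on [GZero]. *)
elim=> {a b} /=; try by right; lia.
- move=> a b ab [a0|->]; last by right.
  by left; apply: gis_trans (gis_sym ab) a0.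
- move=> a b c ab [a0|->] _; first by left.
  by move=> [b0|->]; [left; apply: gis_trans ab b0|right].
- move=> a a' b b' _ [a0|->] _.
    by left; apply: gis_trans (gis_mul a0 (gis_refl _)) (gis_mul0l _).
  move=> [b0|->]; last by right.
  by left; apply: gis_trans (gis_mul (gis_refl _) b0) (gis_mul0r _).
- by left; apply: gis_mul0l.
- by left; apply: gis_mul0r.
Qed.

Lemma gis_neq0 a : ~ gis_eq a GZero -> [gis a] <> zeros.
Proof. by move=> a0 /gis_piP. Qed.

Lemma nat_le_gis_deg t a :
  nat_le [gis t] [gis a] -> gis_eq t GZero \/ gis_deg t = gis_deg a.
Proof.
case; elim/quotW => x [].
rewrite [LHS]gis_mulgE => /gis_piP xx.
rewrite [X in _ = X -> _]gis_mulgE => /gis_piP txa.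
(* Idempotency of [x] gives either [x = 0], hence [t = 0], or [deg x + deg x = deg x], hence
   [deg x = 0]. *)
have [x0|/= dx] := gis_deg_eq _ _ xx; last first.
  by have [|/= ->] := gis_deg_eq _ _ txa; [left|right; lia].
left; apply: gis_trans txa _.
apply: gis_trans (gis_mul (gis_trans (gis_sym xx) x0) (gis_refl _)) _.
exact: gis_mul0l.
Qed.

Lemma omega_gis_deg_neq a b :
  gis_deg a <> gis_deg b -> omega [gis a] [gis b] = [set zeros].
Proof.
move=> dab; apply: omega_eq0; elim/quotW => t ta tb.
apply/gis_piP.
have [//|dta] := nat_le_gis_deg _ _ ta.
by have [//|dtb] := nat_le_gis_deg _ _ tb; case: dab; rewrite -dta.
Qed.

Lemma gis_deg_neq a b :
  ~ gis_eq a GZero -> gis_deg a <> gis_deg b -> [gis a] <> [gis b].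
Proof. by move=> a0 dab /gis_piP /gis_deg_eq[]. Qed.

Lemma gis_vertex_inj : injective (fun v => [gis GVertex v]).
Proof.
(* The vertex [u] fixes the empty path at [u], so [v] must fix it too. *)
move=> u v /gis_piP /gis_act_eq/(_ ([::], u) ([::], u)) /= [uv _].
by case: uv.
Qed.

(** A common lower bound [c] is a left multiple of both idempotents, so [c = c u] and [c = c v],
    whence [c = (c u) v = c (u v) = 0]. *)
Lemma omega_gis_vertex u v :
  u <> v -> omega [gis GVertex u] [gis GVertex v] = [set zeros].
Proof.
move=> uv; apply: omega_eq0; elim/quotW => c.
case; elim/quotW => x [_]; rewrite [X in _ = X -> _]gis_mulgE => /gis_piP cx.
case; elim/quotW => y [_]; rewrite [X in _ = X -> _]gis_mulgE => /gis_piP cy.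
have absorb w z : gis_eq c (GMul w (GVertex z)) ->
    gis_eq c (GMul c (GVertex z)).
  move=> cw; apply: gis_trans (cw) _; apply: gis_sym.
  apply: gis_trans (gis_mul cw (gis_refl _)) _.
  apply: gis_trans (gis_sym (gis_mulA _ _ _)) _.
  exact: gis_mul (gis_refl _) (gis_vv _).
apply/gis_piP; apply: gis_trans (absorb _ _ cy) _.
apply: gis_trans (gis_mul (absorb _ _ cx) (gis_refl _)) _.
apply: gis_trans (gis_sym (gis_mulA _ _ _)) _.
exact: gis_trans (gis_mul (gis_refl _) (gis_uv uv)) (gis_mul0r _).
Qed.

Lemma girth_gis_edge e :
  girth (zero_divisor_graph (graph_inverse_semigroup G)) = Some 3.
Proof.
have v0 := gis_vertex_neq0 (src e); have e0 := gis_edge_neq0 e.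
have i0 := gis_inv_neq0 e.
by apply: (girth_zero_divisor_graph_eq3 _ _ _ _
    (gis_neq0 _ v0) (gis_neq0 _ e0) (gis_neq0 _ i0));
  by [apply: gis_deg_neq | apply: omega_gis_deg_neq].
Qed.

Lemma girth_gis_vertices u v w : u <> v -> v <> w -> u <> w ->
  girth (zero_divisor_graph (graph_inverse_semigroup G)) = Some 3.
Proof.
move=> uv vw uw.
by apply: (girth_zero_divisor_graph_eq3 _ _ _ _
    (gis_neq0 _ (gis_vertex_neq0 u)) (gis_neq0 _ (gis_vertex_neq0 v))
    (gis_neq0 _ (gis_vertex_neq0 w)));
  by [move=> /gis_vertex_inj | apply: omega_gis_vertex].
Qed.

Lemma gis_edgeless t : (edge G -> False) ->
  gis_eq t GZero \/ exists v, gis_eq t (GVertex v).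
Proof.
move=> E0; elim: t => [|v|/E0//|/E0//|a [a0|[u au]] b [b0|[v bv]]].
- by left; apply: gis_refl.
- by right; exists v; apply: gis_refl.
- by left; apply: gis_trans (gis_mul a0 (gis_refl _)) (gis_mul0l _).
- by left; apply: gis_trans (gis_mul a0 (gis_refl _)) (gis_mul0l _).
- by left; apply: gis_trans (gis_mul (gis_refl _) b0) (gis_mul0r _).
have [uv|uv] := pselect (u = v).
  by right; exists u; apply: gis_trans (gis_mul au bv) _; rewrite uv;
     apply: gis_vv.
by left; apply: gis_trans (gis_mul au bv) (gis_uv uv).
Qed.

Lemma girth_gis_two_vertices u v : (edge G -> False) ->
  (forall w, w = u \/ w = v) ->
  girth (zero_divisor_graph (graph_inverse_semigroup G)) = None.
Proof.
move=> E0 Vuv.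
apply: (@girth_eq_None (zero_divisor_graph (graph_inverse_semigroup G))
  (fun x => val x == [gis GVertex u])) => x y.
have nonzeroP (z : set_type (zero_divisors (graph_inverse_semigroup G))) :
    val z = [gis GVertex u] \/ val z = [gis GVertex v].
  case: z => z /= /set_mem [z0 _]; elim/quotW: z z0 => t t0.
  have [/gis_piP//|[w /gis_piP ->]] := gis_edgeless t E0.
  by case: (Vuv w) => ->; [left|right].
(* If the test fails on both [x] and [y], then both are the vertex [v]. *)
move=> xy; apply/val_inj; move: xy; case: eqP => [-> /esym/eqP -> //|xu].
by case: eqP => // yu _; case: (nonzeroP x) => // ->; case: (nonzeroP y).
Qed.

End Graph_inverse_semigroup.

(** * Types with two or with at least three elements *)

Lemma card_geI3 (T : Type) : `I_3 #<= [set: T] ->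
  exists a b c : T, [/\ a <> b, b <> c & a <> c].
Proof.
move=> /card_leP[f].
pose pt n (n3 : (n < 3)%N) : set_type `I_3 := SigSub (mem_set (n3 : `I_3 n)).
exists (val (f (pt 0%N isT))), (val (f (pt 1%N isT))), (val (f (pt 2%N isT))).
by split=> /val_inj /inj; rewrite !in_setT => /(_ isT isT) /(congr1 val).
Qed.

Lemma card_neq_geI3 (T : Type) : [set: T] !=set0 ->
  ~ ([set: T] #= `I_1) -> ~ ([set: T] #= `I_2) -> `I_3 #<= [set: T].
Proof.
move=> T0 T1 T2.
(* An infinite type receives an injection from all natural numbers, in particular from [I_3]. *)
have [[n Tn]|/infiniteP Tinf] := pselect (finite_set [set: T]); last first.
  exact: card_le_trans (subset_card_le (@subsetT _ _)) Tinf.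
rewrite (card_le_eqr Tn) card_le_II.
case: n Tn => [|[|[|//]]] //; rewrite II0 card_eq0 => /eqP T_eq0.
by case: T0 => x; rewrite T_eq0.
Qed.

Lemma card_eqI2 (T : Type) : [set: T] #= `I_2 ->
  exists u v : T, forall w, w = u \/ w = v.
Proof.
(* Elements are removed one at a time; nothing is left after [u] and [v]. *)
case/eq_cardSP => u _ /eq_cardSP[v _]; rewrite II0 card_eq0 => /eqP T0.
exists u, v => w; apply: contrapT => /not_orP[wu wv].
by have : (set0 : set T) w by rewrite -T0.
Qed.

Theorem theorem5p9 (G : digraph) (nontrivG : ~ trivial_digraph G) :
  let gr := girth (zero_divisor_graph (graph_inverse_semigroup G)) in
  [/\ gr = Some 3 \/ gr = None,
      gr = None <-> [set: vertex G] #= `I_2 /\ [set: edge G] #= `I_0 &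
      gr = Some 3 <->
        ~ ([set: edge G] #= `I_0) \/
        `I_3 #<= [set: vertex G] /\ [set: edge G] #= `I_0].
Proof.
move=> gr.
have [E0|E0] := pselect ([set: edge G] #= `I_0); last first.
  have [e _] : [set: edge G] !=set0.
    by apply/set0P; move: E0; rewrite II0 card_eq0 => /negP.
  have -> : gr = Some 3 by apply: girth_gis_edge e.
  by split; [left | split=> // -[] | split=> // _; left].
have noedge : edge G -> False.
  by move=> e; move: E0; rewrite II0 card_eq0 => /eqP/seteqP[/(_ e I)].
have [V2|V2] := pselect ([set: vertex G] #= `I_2).
  have [u [v Vuv]] := card_eqI2 _ V2.
  have -> : gr = None by apply: girth_gis_two_vertices noedge Vuv.
  split; [by right | by [] | split=> // -[//|[]]].
  (* Three vertices among two would give [3 <= 2]. *)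
  by rewrite (card_le_eqr V2) card_le_II.
have V3 : `I_3 #<= [set: vertex G].
  apply: card_neq_geI3 V2; first exact: vertex_neq0.
  (* Without edges, a single vertex would make [G] trivial. *)
  by move=> V1; apply: nontrivG.
have [u [v [w [uv vw uw]]]] := card_geI3 _ V3.
have -> : gr = Some 3 by apply: girth_gis_vertices uv vw uw.
by split; [left | split=> // -[] | split=> // _; right].
Qed.
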